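(* Let $R$ be an integral domain of characteristic zero, $\mathcal{A}_n=R[x_1^{\pm1},\dots,x_n^{\pm1}]$, $q=(q_1,\dots,q_n)$ with $q_i\in R^*$, $A\in M_n(\mathbb{Z})$ an invertible matrix of finite order $r$, and $\phi$ the $R$-algebra endomorphism of $\mathcal{A}_n$ with $\phi(x^\alpha)=q^\alpha x^{A\alpha}$ for all $\alpha\in\mathbb{Z}^n$. Assume that $R$ contains $\mathbb{Q}(q)$, the field of fractions of $\mathbb{Z}[q]\subseteq R$. Let $W=\{\alpha\in\mathbb{Z}^n : q^{\tilde A\alpha}=1\}$, where $\tilde A=\mathrm{I}_n+A+\cdots+A^{r-1}$. If the abelian group $W$ has rank $n$ (e.g., when all $q_i$, $1\le i\le n$, are roots of unity), then $\operatorname{Im}(\mathrm{I}-\phi)$ is a Mathieu subspace of $\mathcal{A}_n$.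
   Context: $R^*$ is the group of units of $R$; $q^\alpha=\prod_i q_i^{\alpha_i}$ and $x^\alpha=\prod_i x_i^{\alpha_i}$ for $\alpha\in\mathbb{Z}^n$; $\mathrm{I}$ is the identity map of $\mathcal{A}_n$. An $R$-submodule $V$ of a commutative $R$-algebra $\mathcal{A}$ is a Mathieu subspace of $\mathcal{A}$ if for all $a,b\in\mathcal{A}$ with $a^m\in V$ for all $m\ge1$, we have $a^mb\in V$ for all sufficiently large $m$. *)

(* Defs.v *)
From HB Require Import structures.
From mathcomp Require Import all_boot all_order all_algebra.
From mathcomp Require Import fraction finmap.
From mathcomp.multinomials Require Import monalg.

Set Implicit Arguments.
Unset Strict Implicit.
Unset Printing Implicit Defensive.

Import GRing.Theory.

Local Open Scope fset_scope.
Local Open Scope ring_scope.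

(* The Laurent polynomial ring R[x_1^{+-1}, ..., x_n^{+-1}], realised as the
   group algebra of Z^n: finitely supported families of coefficients indexed by
   exponent vectors, with the convolution product.  The R-module structure is
   the one of {malg R[_]}; monalg's own ring structure is not available because
   its monomials must have no nontrivial invertible element. *)
Definition laurent (n : nat) (R : comNzRingType) : Type :=
  {malg R['cV[int]_n]}.

HB.instance Definition _ (n : nat) (R : comNzRingType) :=
  GRing.Lmodule.on (laurent n R).

(* The term c x^a.  It is locked, as is the product, because unification
   otherwise tends to unfold these down to finitely supported functions. *)
HB.lock Definition lterm (n : nat) (R : comNzRingType) (c : R)
  (a : 'cV[int]_n) : laurent n R := << c *g a >>.

HB.lock Definition lmul (n : nat) (R : comNzRingType) (f g : laurent n R) :
  laurent n R :=
  \sum_(a <- msupp f) \sum_(b <- msupp g) lterm (f@_a * g@_b) (a + b).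

Definition lmon (n : nat) (R : comNzRingType) (a : 'cV[int]_n) :
  laurent n R := lterm 1 a.

Section LaurentRing.
Variables (n : nat) (R : comNzRingType).

Implicit Types (c d : R) (a b : 'cV[int]_n) (f g h : laurent n R).
Local Notation lmul := (@lmul n R).
Local Notation lmon := (@lmon n R).

Lemma laurentP f g : (forall a, f@_a = g@_a) -> f = g.
Proof. by move/malgP. Qed.

Lemma lcoefD f g a : (f + g)@_a = f@_a + g@_a.
Proof. exact: mcoeffD. Qed.

Lemma lcoefZ c f a : (c *: f)@_a = c * f@_a.
Proof. exact: mcoeffZ. Qed.

Lemma lcoef0 a : (0 : laurent n R)@_a = 0.
Proof. exact: mcoeff0. Qed.

Lemma lcoef_sum (I : Type) (s : seq I) (F : I -> laurent n R) a :
  (\sum_(i <- s) F i)@_a = \sum_(i <- s) (F i)@_a.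
Proof. exact: (big_morph (mcoeff a) (fun f g => lcoefD f g a) (lcoef0 a)). Qed.

Lemma lcoef_term c a b : (lterm c a)@_b = c *+ (a == b).
Proof. rewrite unlock; exact: mcoeffU. Qed.

Lemma lterm0 a : lterm 0 a = 0 :> laurent n R.
Proof. by apply: laurentP => b; rewrite lcoef_term lcoef0 mul0rn. Qed.

Lemma ltermD c d a : lterm (c + d) a = lterm c a + lterm d a.
Proof. by apply: laurentP => b; rewrite lcoefD !lcoef_term mulrnDl. Qed.

Lemma ltermZ c d a : c *: lterm d a = lterm (c * d) a.
Proof. by apply: laurentP => b; rewrite lcoefZ !lcoef_term mulrnAr. Qed.

Lemma lterm_msupp c a : msupp (lterm c a) `<=` [fset a].
Proof. rewrite unlock; exact: msuppU_le. Qed.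

Lemma lterm_sum f : f = \sum_(a <- msupp f) lterm f@_a a.
Proof.
apply: laurentP => b; rewrite lcoef_sum.
under eq_bigr do rewrite lcoef_term.
have [bf|bf] := boolP (b \in msupp f).
  rewrite (big_fsetD1 b) //= eqxx mulr1n big1_fset ?addr0 // => a.
  by rewrite in_fsetD1 => /andP[/negbTE ->].
rewrite big1_fset ?(mcoeff_outdom bf) // => a af _.
by case: eqP bf af => // -> /negbTE ->.
Qed.

Lemma lmulE f g : lmul f g =
  \sum_(a <- msupp f) \sum_(b <- msupp g) lterm (f@_a * g@_b) (a + b).
Proof. by rewrite unlock. Qed.

Lemma lmulw (d1 d2 : {fset 'cV[int]_n}) f g :
  msupp f `<=` d1 -> msupp g `<=` d2 ->
  lmul f g = \sum_(a <- d1) \sum_(b <- d2) lterm (f@_a * g@_b) (a + b).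
Proof.
move=> le_d1 le_d2; rewrite lmulE (big_fset_incl _ le_d1) /=.
  apply/eq_bigr=> a _; apply/big_fset_incl => // b _ /mcoeff_outdom ->.
  by rewrite mulr0 lterm0.
move=> a _ /mcoeff_outdom fa.
by rewrite big1 // => b _; rewrite fa mul0r lterm0.
Qed.

Lemma lmulC : commutative lmul.
Proof.
move=> f g; rewrite !lmulE exchange_big; apply: eq_bigr => a _.
by apply: eq_bigr => b _; rewrite mulrC addrC.
Qed.

Lemma lmul0 g : lmul 0 g = 0.
Proof. by rewrite lmulE msupp0 big_seq_fset0. Qed.

Lemma lmulDl : left_distributive lmul +%R.
Proof.
move=> f g h.
rewrite (lmulw (msuppD_le f g) (fsubset_refl _)).
rewrite (lmulw (fsubsetUl (msupp f) (msupp g)) (fsubset_refl (msupp h))).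
rewrite (lmulw (fsubsetUr (msupp f) (msupp g)) (fsubset_refl (msupp h))).
rewrite -big_split /=; apply/eq_bigr=> a _.
rewrite -big_split /=; apply/eq_bigr=> b _.
by rewrite lcoefD mulrDl ltermD.
Qed.

Lemma lmulDr : right_distributive lmul +%R.
Proof. by move=> f g h; rewrite lmulC lmulDl ![lmul _ f]lmulC. Qed.

Lemma lmul_term c d a b :
  lmul (lterm c a) (lterm d b) = lterm (c * d) (a + b).
Proof.
rewrite (lmulw (lterm_msupp c a) (lterm_msupp d b)) !big_seq_fset1.
by rewrite !lcoef_term !eqxx !mulr1n.
Qed.

Lemma laurent_ind (P : laurent n R -> Prop) :
  P 0 -> (forall f g, P f -> P g -> P (f + g)) ->
  (forall c a, P (lterm c a)) -> forall f, P f.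
Proof.
move=> P0 PD PU f; rewrite (lterm_sum f).
by elim/big_ind: _ => // a _; apply: PU.
Qed.

Lemma lmulA : associative lmul.
Proof.
have lmulg0 f : lmul f 0 = 0 by rewrite lmulC lmul0.
move=> f g h; elim/laurent_ind: f => [|f1 f2 IH1 IH2|c a].
- by rewrite !lmul0.
- by rewrite !lmulDl IH1 IH2.
elim/laurent_ind: g => [|g1 g2 IH1 IH2|d b].
- by rewrite lmulg0 lmul0 lmulg0.
- by rewrite lmulDr !lmulDl lmulDr IH1 IH2.
elim/laurent_ind: h => [|h1 h2 IH1 IH2|e k].
- by rewrite !lmulg0.
- by rewrite !lmulDr IH1 IH2.
by rewrite !lmul_term mulrA addrA.
Qed.

Lemma lmul1 : left_id (lmon 0) lmul.
Proof.
elim/laurent_ind => [|f g IHf IHg|c a].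
- by rewrite lmulC lmul0.
- by rewrite lmulDr IHf IHg.
by rewrite lmul_term mul1r add0r.
Qed.

Lemma lmon0_neq0 : lmon 0 != 0.
Proof.
apply/eqP => /(congr1 (mcoeff 0)) /eqP.
by rewrite lcoef_term lcoef0 eqxx oner_eq0.
Qed.

HB.instance Definition _ := GRing.Zmodule_isComNzRing.Build (laurent n R)
  lmulA lmulC lmul1 lmulDl lmon0_neq0.

Lemma lscaleAl c f g : c *: (f * g) = (c *: f) * g.
Proof.
elim/laurent_ind: f => [|f1 f2 IH1 IH2|d a].
- by rewrite scaler0 mul0r scaler0.
- by rewrite scalerDr !mulrDl scalerDr IH1 IH2.
elim/laurent_ind: g => [|g1 g2 IH1 IH2|e b].
- by rewrite !mulr0 scaler0.
- by rewrite !mulrDr scalerDr IH1 IH2.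
by rewrite ltermZ [_ * _]lmul_term [RHS]lmul_term ltermZ mulrA.
Qed.

HB.instance Definition _ :=
  GRing.Lmodule_isLalgebra.Build R (laurent n R) lscaleAl.
HB.instance Definition _ := GRing.Lalgebra_isComAlgebra.Build R (laurent n R).

Lemma lmon0 : lmon 0 = 1. Proof. by []. Qed.

Lemma lmonD a b : lmon (a + b) = lmon a * lmon b.
Proof. by rewrite [RHS]lmul_term mulr1. Qed.

Lemma lmonMn a k : lmon (a *+ k) = lmon a ^+ k.
Proof. by elim: k => // k IHk; rewrite mulrS exprS lmonD IHk. Qed.

Lemma lmon_sum (I : Type) (s : seq I) (F : I -> 'cV[int]_n) :
  lmon (\sum_(i <- s) F i) = \prod_(i <- s) lmon (F i).
Proof. exact: (big_morph lmon lmonD lmon0). Qed.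

Lemma laurentE f : f = \sum_(a <- msupp f) f@_a *: lmon a.
Proof.
rewrite [LHS]lterm_sum; apply: eq_bigr => a _.
by rewrite [RHS]ltermZ mulr1.
Qed.

Definition lvar (i : 'I_n) : laurent n R := lmon (delta_mx i 0).
Definition lvarV (i : 'I_n) : laurent n R := lmon (- delta_mx i 0).

Lemma lvarK i : lvar i * lvarV i = 1.
Proof. by rewrite -lmonD subrr. Qed.

Lemma lmonE a :
  lmon a = \prod_i (if 0 <= a i 0 then lvar i else lvarV i) ^+ absz (a i 0).
Proof.
have natZ (i : 'I_n) (k : nat) :
    k%:Z *: delta_mx i 0 = delta_mx i 0 *+ k :> 'cV[int]_n.
  by apply/matrixP => u v; rewrite mulmxnE !mxE -[RHS]mulr_natl (natz k).
rewrite [a in LHS]matrix_sum_delta lmon_sum; apply: eq_bigr => i _.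
rewrite big_ord1; case: (a i 0) => k /=; first by rewrite natZ lmonMn.
by rewrite NegzE scaleNr natZ -mulNrn lmonMn.
Qed.

End LaurentRing.

Definition submodule (R : pzRingType) (M : lmodType R) (V : M -> Prop) : Prop :=
  [/\ V 0, (forall u v, V u -> V v -> V (u + v))
    & (forall (c : R) u, V u -> V (c *: u))].

Definition mathieu_subspace (R : comNzRingType) (B : comAlgType R)
    (V : B -> Prop) : Prop :=
  submodule V /\
  forall a b : B, (forall m, (1 <= m)%N -> V (a ^+ m)) ->
    exists N, forall m, (N <= m)%N -> V (a ^+ m * b).

Definition Im_id_sub (R : comNzRingType) (B : comAlgType R) (phi : B -> B) :
  B -> Prop := fun f => exists g, f = g - phi g.

Definition qpow (n : nat) (R : unitRingType) (q : 'I_n -> R) (a : 'cV[int]_n) :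
  R := \prod_i q i ^ a i 0.

Definition mx_order (n : nat) (A : 'M[int]_n) (r : nat) : Prop :=
  [/\ (0 < r)%N, A ^+ r = 1%:M
    & forall k, (0 < k)%N -> A ^+ k = 1%:M -> (r <= k)%N].

Definition Atilde (n : nat) (A : 'M[int]_n) (r : nat) : 'M[int]_n :=
  \sum_(k < r) A ^+ k.

Definition Wq (n : nat) (R : unitRingType) (q : 'I_n -> R) (A : 'M[int]_n)
    (r : nat) : 'cV[int]_n -> Prop :=
  fun a => qpow q (Atilde A r *m a) = 1.

Lemma qpowD (n : nat) (R : comUnitRingType) (q : 'I_n -> R) (a b : 'cV[int]_n) :
  (forall i, q i \is a GRing.unit) -> qpow q (a + b) = qpow q a * qpow q b.
Proof.
move=> hq; rewrite /qpow -big_split /=.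
by apply: eq_bigr => i _; rewrite mxE exprzDr.
Qed.

Lemma Wq_subgroup (n : nat) (R : comUnitRingType) (q : 'I_n -> R)
    (A : 'M[int]_n) (r : nat) : (forall i, q i \is a GRing.unit) ->
  Wq q A r 0 /\ (forall a b, Wq q A r a -> Wq q A r b -> Wq q A r (a - b)).
Proof.
move=> hq; split=> [|a b]; rewrite /Wq.
  by rewrite mulmx0 /qpow big1 // => i _; rewrite mxE expr0z.
move=> Wa Wb; rewrite mulmxBr -[LHS]mulr1 -[in LHS]Wb -qpowD //.
by rewrite subrK Wa.
Qed.

Definition Z_independent (G : zmodType) (k : nat) (v : 'I_k -> G) : Prop :=
  forall c : 'I_k -> int, \sum_i v i *~ c i = 0 -> forall i, c i = 0.

(* The rank of an abelian group: the maximal size of a Z-independent family. *)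
Definition has_rank (G : zmodType) (W : G -> Prop) (k : nat) : Prop :=
  (exists v : 'I_k -> G, (forall i, W (v i)) /\ Z_independent v) /\
  (forall l (v : 'I_l -> G), (forall i, W (v i)) -> Z_independent v ->
     (l <= k)%N).

(* Z[q], the subring of R generated by the q_i. *)
Inductive Zgen (n : nat) (R : nzRingType) (q : 'I_n -> R) : R -> Prop :=
| Zgen_var i : Zgen q (q i)
| Zgen1 : Zgen q 1
| ZgenB a b : Zgen q a -> Zgen q b -> Zgen q (a - b)
| ZgenM a b : Zgen q a -> Zgen q b -> Zgen q (a * b).

(* Q(q), as a subfield of the field of fractions of R. *)
Definition Qgen (n : nat) (R : idomainType) (q : 'I_n -> R) :
    {fraction R} -> Prop :=
  fun z => exists a b,
    [/\ Zgen q a, Zgen q b, b != 0 & z = tofrac a / tofrac b].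

Definition contains_Qgen (n : nat) (R : idomainType) (q : 'I_n -> R) : Prop :=
  forall z, Qgen q z -> exists c : R, z = tofrac c.

(* Main.v *)
(* If d > 0 is the absolute value of the determinant of n independent vectors of
   W, then W contains d Z^n, so q^(Atilde a) is a d-th root of unity for all a
   and phi^N = I with N = d r.  Summing over the orbit kills Im(I - phi), so if
   a^m lies in Im(I - phi) for all m >= 1, all power sums of the phi^i(a), i < N,
   vanish.  In the torsion-free ring A_n this forces a to be nilpotent, and the
   Mathieu condition holds trivially. *)
Require Import Defs.
From HB Require Import structures.
From mathcomp Require Import all_boot all_order all_algebra.
From mathcomp Require Import ring.

Set Implicit Arguments.
Unset Strict Implicit.
Unset Printing Implicit Defensive.

Import GRing.Theory Num.Theory.
Local Open Scope ring_scope.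

(** * Power sums and nilpotency *)

(* Truncation at order M of E'/E = - sum_m p_(m+1) X^m for E = prod (1 - y X),
   where p_m is the m-th power sum. *)
Lemma deriv_prod_power_sums (B : comNzRingType) (s : seq B) (M : nat) :
  exists H : {poly B}, (\prod_(y <- s) (1 - y *: 'X))^`() =
    'X^M * H - (\prod_(y <- s) (1 - y *: 'X))
               * (\sum_(m < M) (\sum_(y <- s) y ^+ m.+1) *: 'X^m).
Proof.
elim: s => [|y s [H IH]].
  exists 0; rewrite big_nil derivC mulr0 sub0r big1 ?mulr0 ?oppr0 // => m _.
  by rewrite big_nil scale0r.
rewrite big_cons; set E := \prod_(y <- s) _ in IH *.
have -> : \sum_(m < M) (\sum_(z <- y :: s) z ^+ m.+1) *: 'X^m =
    y *: (\sum_(m < M) (y *: 'X) ^+ m)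
    + \sum_(m < M) (\sum_(z <- s) z ^+ m.+1) *: 'X^m :> {poly B}.
  rewrite scaler_sumr -big_split /=; apply: eq_bigr => m _.
  by rewrite big_cons scalerDl exprZn scalerA -exprS.
have geom : (1 - y *: 'X) * (\sum_(m < M) (y *: 'X) ^+ m)
    = 1 - y ^+ M *: 'X^M.
  by rewrite -exprZn -[RHS]opprB subrX1 -mulNr opprB.
(* The second term cancels the remainder [y ^+ M *: 'X^M] that [geom] leaves from the truncated
   geometric series. *)
exists ((1 - y *: 'X) * H - y%:P * (y ^+ M)%:P * E).
rewrite derivM IH derivB derivZ derivX derivC sub0r alg_polyC -!mul_polyC.
move: geom; rewrite -!mul_polyC.
move: (\sum_(m < M) _) (\sum_(m < M) _) => T S geom.
have -> : 'X^M * ((1 - y%:P * 'X) * H - y%:P * (y ^+ M)%:P * E)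
    - (1 - y%:P * 'X) * E * (y%:P * S + T)
  = 'X^M * (1 - y%:P * 'X) * H - y%:P * ((y ^+ M)%:P * 'X^M) * E
    - ((1 - y%:P * 'X) * S) * E * y%:P - (1 - y%:P * 'X) * E * T by ring.
by rewrite geom; ring.
Qed.

(** Vanishing power sums make the derivative of E = prod (1 - y X) divisible by every power of X,
    hence zero, and torsion-freeness gives E = 1. Each factor 1 - y X is then invertible in B[X],
    which forces y to be nilpotent. *)
Lemma power_sums_eq0_nilpotent (B : comNzRingType) (s : seq B) :
  (forall k (b : B), b *+ k.+1 = 0 -> b = 0) ->
  (forall m, (0 < m)%N -> \sum_(y <- s) y ^+ m = 0) ->
  forall y, y \in s -> exists k, y ^+ k = 0.
Proof.
move=> tfB ps0 y sy; set E := \prod_(y <- s) (1 - y *: 'X).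
(* The order [size E] is beyond the degree of the derivative of [E]. *)
have [H] := deriv_prod_power_sums s (size E); rewrite -/E.
rewrite big1 => [|m _]; last by rewrite ps0 ?scale0r.
rewrite mulr0 subr0 => dE.
have E1 : E = 1.
  apply/polyP => -[|k]; rewrite coef1 /=.
    rewrite -horner_coef0 horner_prod big1 // => z _.
    by rewrite hornerD hornerN hornerZ hornerX hornerC mulr0 subr0.
  have [lt_k|le_k] := ltnP k (size E); last first.
    by rewrite nth_default // leqW.
  by apply: (tfB k); rewrite -coef_deriv dE coefXnM lt_k.
have [F EF] : exists F, (1 - y *: 'X) * F = 1.
  exists (\prod_(z <- rem y s) (1 - z *: 'X)).
  by rewrite -[RHS]E1 /E (big_rem y sy).
(* F is the geometric series of y X, hence y ^+ k vanishes beyond its size. *)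
have Fk k : F`_k = y ^+ k.
  elim: k => [|k IH]; have /polyP := EF; first move/(_ 0).
    by rewrite mulrBl mul1r -scalerAl coefB coefZ coefXM mulr0 subr0 coef1.
  move/(_ k.+1); rewrite mulrBl mul1r -scalerAl coefB coefZ coefXM coef1 /=.
  by move/subr0_eq ->; rewrite IH -exprS.
by exists (size F); rewrite -Fk nth_default.
Qed.

(** * Torsion-freeness, and the image of I - phi for phi of finite order *)

Lemma laurent_torsion_free (n : nat) (R : idomainType) :
  [pchar R] =i pred0 ->
  forall k (f : laurent n R), f *+ k.+1 = 0 -> f = 0.
Proof.
move=> /pcharf0P charR k f; rewrite -scaler_nat => fk0.
apply: laurentP => a; move/(congr1 (monalg.mcoeff a)): fk0.
rewrite lcoefZ lcoef0 => /eqP.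
by rewrite mulf_eq0 charR /= => /eqP.
Qed.

Lemma Im_id_sub_submodule (R : comNzRingType) (B : comAlgType R)
    (phi : {lrmorphism B -> B}) : submodule (Im_id_sub phi).
Proof.
split.
- by exists 0; rewrite rmorph0 subr0.
- by move=> _ _ [f ->] [g ->]; exists (f + g); rewrite rmorphD opprD addrACA.
- by move=> c _ [f ->]; exists (c *: f); rewrite linearZ scalerBr.
Qed.

Lemma iter_rmorphX (B : comNzRingType) (phi : {rmorphism B -> B}) k (a : B) m :
  iter k phi (a ^+ m) = iter k phi a ^+ m.
Proof. by elim: k => //= k ->; rewrite rmorphXn. Qed.

(** On [g - phi g] the sum telescopes to [g - iter N phi g]. *)
Lemma Im_id_sub_orbit_sum (R : comNzRingType) (B : comAlgType R)
    (phi : {lrmorphism B -> B}) (N : nat) (f : B) :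
  (forall g, iter N phi g = g) -> Im_id_sub phi f ->
  \sum_(i < N) iter i phi f = 0.
Proof.
move=> phiN [g ->].
have iterB i : iter i phi (g - phi g) = iter i phi g - iter i.+1 phi g.
  elim: i => //= i ->; exact: rmorphB.
under eq_bigr do rewrite iterB -opprB.
rewrite -(big_mkord xpredT (fun i => - (iter i.+1 phi g - iter i phi g))).
by rewrite sumrN telescope_sumr // phiN subrr oppr0.
Qed.

Lemma mathieu_Im_id_sub_finite_order (R : comNzRingType) (B : comAlgType R)
    (phi : {lrmorphism B -> B}) (N : nat) :
  (forall k (b : B), b *+ k.+1 = 0 -> b = 0) ->
  (0 < N)%N -> (forall g, iter N phi g = g) -> mathieu_subspace (Im_id_sub phi).
Proof.
move=> tfB N_gt0 phiN; split=> [|a b aV]; first exact: Im_id_sub_submodule.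
have psum m : (0 < m)%N ->
    \sum_(y <- [seq iter i phi a | i <- iota 0 N]) y ^+ m = 0.
  move=> m_gt0; rewrite big_map -[N]subn0 big_mkord.
  rewrite -[RHS](Im_id_sub_orbit_sum phiN (aV m m_gt0)).
  by apply: eq_bigr => i _; rewrite iter_rmorphX.
have [|k ak0] := power_sums_eq0_nilpotent tfB psum (y := a).
  by apply/mapP; exists 0; rewrite // mem_iota.
exists k => m le_km; rewrite -(subnK le_km) exprD ak0 mulr0 mul0r.
by case: (Im_id_sub_submodule phi).
Qed.

(** * Integer relations and determinants *)

Lemma mulmxzE (V : zmodType) (m n : nat) (a : 'M[V]_(m, n)) (z : int) i j :
  (a *~ z) i j = a i j *~ z.
Proof.
case: z => k; first by rewrite -!pmulrn mulmxnE.
by rewrite !NegzE !mulrNz -!pmulrn !mxE mulmxnE.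
Qed.

Lemma sum_mulrz_mulmx (n l : nat) (v : 'I_l -> 'cV[int]_n) (c : 'I_l -> int) :
  \sum_i v i *~ c i = (\matrix_(i, j) v j i 0) *m (\col_i c i).
Proof.
apply/matrixP => i j; rewrite ord1 summxE !mxE.
by apply: eq_bigr => k _; rewrite mulmxzE mulrzz !mxE.
Qed.

(** A zero determinant would give a nonzero integer vector in the kernel, that is, a nontrivial
    relation between the columns. *)
Lemma Z_independent_det_neq0 (n : nat) (v : 'I_n -> 'cV[int]_n) :
  Z_independent v -> \det (\matrix_(i, j) v j i 0) != 0.
Proof.
move=> indv; rewrite -det_tr; apply/det0P => -[u /negP u_neq0 uV].
case: u_neq0; apply/eqP/rowP => i; rewrite mxE; apply: (indv (u 0)).
rewrite sum_mulrz_mulmx -[RHS]trmx0 -uV trmx_mul trmxK; congr (_ *m _).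
by apply/matrixP => k l; rewrite !mxE ord1.
Qed.

(* Padding with zero columns reduces to square matrices. *)
Lemma Z_independent_leq (n l : nat) (v : 'I_l -> 'cV[int]_n) :
  Z_independent v -> (l <= n)%N.
Proof.
move=> indv; rewrite leqNgt; apply/negP => lt_nl.
(* Writing [l] as [n + k.+1] makes the padded matrix square with at least one zero column. *)
have := subnKC lt_nl; rewrite addSnnS; move: (l - n.+1)%N => k def_l.
subst l; set V := \matrix_(i, j) v j i 0 : 'M_(n, n + k.+1).
have /det0P[u u_neq0 uV] : \det (row_mx V^T (0 : 'M_(n + k.+1, k.+1))) == 0.
  rewrite -det_tr; apply/det0P; exists (delta_mx 0 (rshift n ord0)).
    apply/eqP => /rowP/(_ (rshift n ord0)) /eqP.
    by rewrite !mxE !eqxx.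
  by rewrite -rowE tr_row_mx rowKd trmx0 row0.
case/eqP: u_neq0; apply/rowP => i; rewrite mxE; apply: (indv (u 0)).
move: uV; rewrite mul_mx_row -[0 in RHS]row_mx0 => /eq_row_mx[uV _].
rewrite sum_mulrz_mulmx -[RHS]trmx0 -uV trmx_mul trmxK; congr (_ *m _).
by apply/matrixP => j j'; rewrite !mxE ord1.
Qed.

Lemma subgroup_lincomb (G : zmodType) (W : G -> Prop) (l : nat)
    (v : 'I_l -> G) (c : 'I_l -> int) :
  W 0 -> (forall a b, W a -> W b -> W (a - b)) -> (forall i, W (v i)) ->
  W (\sum_i v i *~ c i).
Proof.
move=> W0 WB Wv.
have WN a : W a -> W (- a) by move=> Wa; rewrite -sub0r; apply: WB.
have WD a b : W a -> W b -> W (a + b).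
  by move=> Wa Wb; rewrite -[b]opprK; apply: WB => //; apply: WN.
have WMn a k : W a -> W (a *+ k).
  by move=> Wa; elim: k => // k IHk; rewrite mulrS; apply: WD.
elim/big_ind: _ => // i _; case: (c i) => k; first exact: WMn.
by rewrite NegzE mulrNz; apply/WN/WMn.
Qed.

(** * The rank of W and powers of q *)

Lemma qpow0 (n : nat) (R : unitRingType) (q : 'I_n -> R) : qpow q 0 = 1.
Proof. by rewrite /qpow big1 // => i _; rewrite mxE expr0z. Qed.

Lemma qpowMn (n : nat) (R : comUnitRingType) (q : 'I_n -> R) (a : 'cV[int]_n) k :
  (forall i, q i \is a GRing.unit) -> qpow q (a *+ k) = qpow q a ^+ k.
Proof.
move=> q_unit; elim: k => [|k IHk]; first by rewrite qpow0.
by rewrite mulrS exprS qpowD ?IHk.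
Qed.

Lemma Wq_full_rank_exponent (n : nat) (R : comUnitRingType) (q : 'I_n -> R)
    (A : 'M[int]_n) (r : nat) :
  (forall i, q i \is a GRing.unit) -> has_rank (Wq q A r) n ->
  exists2 d, (0 < d)%N & forall a, qpow q (Atilde A r *m a) ^+ d = 1.
Proof.
move=> q_unit [[v [Wv indv]] _]; set V := \matrix_(i, j) v j i 0.
have [W0 WB] := Wq_subgroup A r q_unit.
have detV : \det V != 0 by apply: Z_independent_det_neq0.
exists `|\det V|%N => [|a]; first by rewrite absz_gt0.
have WdetV : Wq q A r (\det V *: a).
  (* As det V a = V (adj V a), this vector is an integer combination of the columns of [V], which
     lie in W. *)
  rewrite -mul_scalar_mx -mul_mx_adj -mulmxA.
  rewrite (_ : \adj V *m a = \col_i (\adj V *m a) i 0); last first.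
    by apply/matrixP => i j; rewrite ord1 [RHS]mxE.
  by rewrite -sum_mulrz_mulmx; apply: subgroup_lincomb.
have Wabs : Wq q A r (a *+ `|\det V|).
  rewrite -scaler_nat natz abszE.
  case: (ger0P (\det V)) => _ //.
  by rewrite scaleNr -sub0r; apply: WB.
by rewrite -qpowMn // -(raddfMn (mulmx _)).
Qed.

(** If K is a common exponent of the q_i, every K e_i lies in W; these n vectors are independent,
    and Z^n has no larger independent family. *)
Lemma Wq_roots_of_unity (n : nat) (R : comUnitRingType) (q : 'I_n -> R)
    (A : 'M[int]_n) (r : nat) :
  (forall i, q i \is a GRing.unit) ->
  (forall i, exists2 k, (0 < k)%N & k.-unity_root (q i)) ->
  has_rank (Wq q A r) n.
Proof.
move=> q_unit q_root; split; last by move=> l v _; apply: Z_independent_leq.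
have [K K_gt0 qK] : exists2 K, (0 < K)%N & forall i, q i ^+ K = 1.
  have /fin_all_exists2[k k_gt0 qk] := q_root.
  exists (\prod_i k i)%N => [|i]; first by rewrite prodn_gt0.
  rewrite (bigD1 i) //= exprM.
  by have /unity_rootP -> := qk i; rewrite expr1n.
exists (fun i => delta_mx i 0 *+ K); split=> [i|c sum0 i].
  rewrite /Wq (raddfMn (mulmx _)) qpowMn // /qpow -prodrXl big1 // => j _.
  by rewrite exprnP exprz_exp mulrC -exprz_exp -exprnP qK exp1rz.
have /colP/(_ i) := sum0; rewrite summxE (bigD1 i) //= big1 ?addr0.
  rewrite mulmxzE mulrzz mulmxnE !mxE !eqxx => /eqP.
  by rewrite mulf_eq0 pnatr_eq0 -[K == 0]negbK -lt0n K_gt0 => /eqP.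
move=> j /negbTE ji.
by rewrite mulmxzE mulrzz mulmxnE !mxE eq_sym ji mul0rn mul0r.
Qed.

(** * Iterates of phi on monomials *)

Lemma iter_linearD (R : pzRingType) (V : lmodType R) (h : {linear V -> V}) k u v :
  iter k h (u + v) = iter k h u + iter k h v.
Proof. by elim: k => //= k ->; rewrite linearD. Qed.

Lemma iter_linearZ (R : pzRingType) (V : lmodType R) (h : {linear V -> V}) k c u :
  iter k h (c *: u) = c *: iter k h u.
Proof. by elim: k => //= k ->; rewrite linearZ. Qed.

(** Applying [phi] to x^(A^k a) contributes the factor q^(A^k a), so the exponents add up to the
    partial sums [Atilde A k], taken here at every [k] and not only at the order of [A]. *)
Lemma iter_lmon (n : nat) (R : comUnitRingType) (q : 'I_n -> R)
    (A : 'M[int]_n) (phi : {lrmorphism laurent n R -> laurent n R}) :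
  (forall i, q i \is a GRing.unit) ->
  (forall a : 'cV[int]_n, phi (lmon R a) = qpow q a *: lmon R (A *m a)) ->
  forall k a, iter k phi (lmon R a) =
    qpow q (Atilde A k *m a) *: lmon R (A ^+ k *m a).
Proof.
move=> q_unit phiE; elim=> [|k IHk] a /=.
  rewrite /Atilde big_ord0 mul0mx qpow0.
  by rewrite scale1r expr0 mul1mx.
have phiZ c f : phi (c *: f) = c *: phi f by exact: linearZ.
rewrite IHk phiZ phiE scalerA -(qpowD _ _ q_unit) -mulmxDl.
by rewrite /Atilde big_ord_recr /= exprS -mulmxE mulmxA.
Qed.

Lemma iter_lmon_id (n : nat) (R : comNzRingType)
    (phi : {lrmorphism laurent n R -> laurent n R}) N :
  (forall a, iter N phi (lmon R a) = lmon R a) -> forall f, iter N phi f = f.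
Proof.
move=> phiN.
elim/laurent_ind => [|f g IHf IHg|c a].
- by elim: N {phiN} => //= k ->; rewrite rmorph0.
- by rewrite iter_linearD IHf IHg.
- by rewrite -[c]mulr1 -ltermZ iter_linearZ phiN.
Qed.

Theorem lemma3p5 (n : nat) (R : idomainType) (q : 'I_n -> R)
    (A : 'M[int]_n) (r : nat)
    (phi : {lrmorphism laurent n R -> laurent n R}) :
  [pchar R] =i pred0 ->
  (forall i, q i \is a GRing.unit) ->
  A \in unitmx ->
  mx_order A r ->
  (forall a : 'cV[int]_n, phi (lmon R a) = qpow q a *: lmon R (A *m a)) ->
  contains_Qgen q ->
  ((forall i, exists2 k, (0 < k)%N & k.-unity_root (q i)) ->
     has_rank (Wq q A r) n) /\
  (has_rank (Wq q A r) n -> mathieu_subspace (Im_id_sub phi)).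
Proof.
move=> charR q_unit _ [r_gt0 Ar _] phiE _; split.
  exact: Wq_roots_of_unity.
move=> /(Wq_full_rank_exponent q_unit)[d d_gt0 qd].
apply: (@mathieu_Im_id_sub_finite_order _ _ _ (d * r)); last 1 first.
- apply: iter_lmon_id => a.
  (* Since [A ^+ r] is the identity, each block of r iterations fixes x^a up to the scalar q^(Atilde
     a), whose d-th power is 1. *)
  suff iter_dr k : iter (k * r) phi (lmon R a) =
      qpow q (Atilde A r *m a) ^+ k *: lmon R a by rewrite iter_dr qd scale1r.
  elim: k => [|k IHk]; first by rewrite scale1r.
  rewrite mulSn iterD IHk iter_linearZ (iter_lmon q_unit phiE) Ar mul1mx.
  by rewrite scalerA -exprSr.
- exact: laurent_torsion_free.
- by rewrite muln_gt0 d_gt0.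
Qed.
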